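(* For every $\epsilon\in(0,1)$ and positive integers $L,k$ there is a positive integer $M$ such that for all $m,n\ge M$ and for every sequence $A^{(1)},\ldots,A^{(k)}$ of $m\times n$ real matrices with nonnegative entries there is a block partition $(\mathcal P,\mathcal Q)$ with $|\mathcal P|,|\mathcal Q|\in[L,M]$ that is simultaneously $(\epsilon)$-regular for each $A^{(i)}$.
   Context: For a real matrix $A$ with rows indexed by $V$ and columns by $W$, $\|A\|=\sum_{x,y}|a_{xy}|$, and for nonempty $X\subset V$, $Y\subset W$, $d_A(X,Y)=\frac{1}{|X||Y|}\sum_{x\in X,y\in Y}a_{xy}$. A block $(X,Y)$ is $\epsilon$-regular for $A$ if for all $X'\subset X$, $Y'\subset Y$ with $|X'|\ge\epsilon|X|$, $|Y'|\ge\epsilon|Y|$, $|d_A(X',Y')-d_A(X,Y)|\le\epsilon$. A block partition $(\mathcal P,\mathcal Q)$ is a partition $\mathcal P$ of $V$ and $\mathcal Q$ of $W$ with designated (possibly empty) exceptional classes $V_0\in\mathcal P$, $W_0\in\mathcal Q$; $|\mathcal P|,|\mathcal Q|$ count nonexceptional classes; a partition is balanced if its nonexceptional classes have equal sizes. $(\mathcal P,\mathcal Q)$ is $\epsilon$-regular for $A$ if $\mathcal P,\mathcal Q$ are balanced, $|V_0|<\epsilon|V|$, $|W_0|<\epsilon|W|$, and all but at most $\epsilon|\mathcal P||\mathcal Q|$ blocks $(X,Y)$ with $X\in\mathcal P\setminus\{V_0\}$, $Y\in\mathcal Q\setminus\{W_0\}$ are $\epsilon$-regular for $A$. It is $(\epsilon)$-regular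 for $A$ if it is $\epsilon$-regular for $A^*=\frac{|V||W|}{\|A\|}A$. *)

(* Defs.v *)
From mathcomp Require Import all_boot all_order all_algebra.
From mathcomp Require Import reals.

Set Implicit Arguments.
Unset Strict Implicit.
Unset Printing Implicit Defensive.

Import Order.TTheory GRing.Theory Num.Theory.
Local Open Scope ring_scope.

(* A partition of T with a designated, possibly empty, exceptional class.
   [classes] lists the nonexceptional classes only; by the definition of
   [partition] they are nonempty, pairwise disjoint, and cover the complement
   of [exc_class]. *)
Record exc_partition (T : finType) := ExcPartition {
  exc_class : {set T};
  classes : {set {set T}};
  _ : partition classes (~: exc_class)
}.

Definition nclasses (T : finType) (P : exc_partition T) : nat := #|classes P|.

Definition balanced (T : finType) (P : exc_partition T) : bool :=
  [forall X in classes P, forall Y in classes P, #|X| == #|Y|].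

Definition entry_norm (R : realType) (m n : nat) (A : 'M[R]_(m, n)) : R :=
  \sum_x \sum_y `|A x y|.

Definition density (R : realType) (m n : nat) (A : 'M[R]_(m, n))
    (X : {set 'I_m}) (Y : {set 'I_n}) : R :=
  (#|X|%:R * #|Y|%:R)^-1 * \sum_(x in X) \sum_(y in Y) A x y.

Definition regular_block (R : realType) (eps : R) (m n : nat)
    (A : 'M[R]_(m, n)) (X : {set 'I_m}) (Y : {set 'I_n}) : bool :=
  [forall X' : {set 'I_m}, forall Y' : {set 'I_n},
     [&& X' \subset X, Y' \subset Y,
         eps * #|X|%:R <= #|X'|%:R & eps * #|Y|%:R <= #|Y'|%:R]
     ==> (`|density A X' Y' - density A X Y| <= eps)].

Definition irregular_blocks (R : realType) (eps : R) (m n : nat)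
    (A : 'M[R]_(m, n)) (P : exc_partition 'I_m) (Q : exc_partition 'I_n) :
    {set {set 'I_m} * {set 'I_n}} :=
  [set B in setX (classes P) (classes Q) | ~~ regular_block eps A B.1 B.2].

Definition regular_partition (R : realType) (eps : R) (m n : nat)
    (A : 'M[R]_(m, n)) (P : exc_partition 'I_m) (Q : exc_partition 'I_n) :
    Prop :=
  [/\ balanced P /\ balanced Q,
      #|exc_class P|%:R < eps * m%:R,
      #|exc_class Q|%:R < eps * n%:R &
      #|irregular_blocks eps A P Q|%:R
        <= eps * (nclasses P)%:R * (nclasses Q)%:R].

(* A^* = (m n / ||A||) A.  For A = 0 the quotient is 0 by the convention
   0^-1 = 0, so the normalization of the zero matrix is the zero matrix. *)
Definition normalize_mx (R : realType) (m n : nat) (A : 'M[R]_(m, n)) :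
    'M[R]_(m, n) :=
  (m%:R * n%:R / entry_norm A) *: A.

(* The notion written "(eps)-regular", with parentheses. *)
Definition normalized_regular_partition (R : realType) (eps : R) (m n : nat)
    (A : 'M[R]_(m, n)) (P : exc_partition 'I_m) (Q : exc_partition 'I_n) :
    Prop :=
  regular_partition eps (normalize_mx A) P Q.

(* Main.v *)
(* Energy increment.  Normalized matrices have average entry at most 1 but
   unbounded entries, so the usual quadratic energy is not bounded; it is
   replaced by the sum over all positions of [1 / (1 + d)], [d] being the
   density of the block containing the position.  This function is convex and
   lies in [[0, 1]], so the energy is at most [m n] for free, and its convexity
   gap is uniform on blocks of density at most [8 / eps].  By Markov's
   inequality the denser blocks cover at most a fraction [eps / 8] of the
   positions, hence an irregular partition has enough irregular blocks of
   moderate density.  Points of the exceptional classes count as singleton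
   blocks, so refining never lowers the energy, even when the exceptional
   classes grow. *)
Require Import Defs.
From mathcomp Require Import all_boot all_order all_algebra.
From mathcomp Require Import reals.
From mathcomp Require Import ring lra.

Import Order.TTheory GRing.Theory Num.Theory.
Local Open Scope ring_scope.

(** * Convexity of [1 / (1 + t)] *)

Definition inv1p {R : realType} (t : R) : R := (1 + t)^-1.

Lemma inv1p_ge0 {R : realType} (t : R) : 0 <= t -> 0 <= inv1p t.
Proof. by move=> t0; rewrite invr_ge0 addr_ge0. Qed.

Lemma inv1p_le1 {R : realType} (t : R) : 0 <= t -> inv1p t <= 1.
Proof. by move=> t0; rewrite invf_le1 ?lerDl// ltr_pwDl. Qed.

(** The second-order expansion is exact, with an explicit remainder: its sign gives convexity, its
    size the gap. *)
Lemma inv1p_taylor {R : realType} (d t : R) : 0 <= d -> 0 <= t ->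
  inv1p t = inv1p d - (t - d) / (1 + d) ^+ 2
            + (t - d) ^+ 2 / ((1 + t) * (1 + d) ^+ 2).
Proof.
move=> d0 t0; rewrite /inv1p; field.
by rewrite !gt_eqF// ltr_pwDl.
Qed.

Lemma inv1p_tangent {R : realType} (d t : R) : 0 <= d -> 0 <= t ->
  inv1p d - (t - d) / (1 + d) ^+ 2 <= inv1p t.
Proof.
move=> d0 t0; rewrite (inv1p_taylor d t)// lerDl.
by rewrite divr_ge0 ?sqr_ge0// mulr_ge0 ?sqr_ge0// addr_ge0.
Qed.

(** Lower bound for the Taylor remainder when [d <= D] and [|t - d| > eps]; [2 + D] bounds
    [1 + d + eps]. *)
Definition gap {R : realType} (eps D : R) : R :=
  eps ^+ 2 / ((2 + D) * (1 + D) ^+ 2).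

Lemma gap_gt0 {R : realType} (eps D : R) : 0 < eps -> 0 <= D -> 0 < gap eps D.
Proof.
move=> e0 D0; rewrite divr_gt0 ?exprn_gt0// mulr_gt0// ?exprn_gt0//; lra.
Qed.

Lemma inv1p_gap {R : realType} (eps D d t : R) : 0 < eps < 1 ->
  0 <= d <= D -> 0 <= t -> eps < `|t - d| ->
  inv1p d - (t - d) / (1 + d) ^+ 2 + gap eps D <= inv1p t.
Proof.
move=> /andP[e0 e1] /andP[d0 dD] t0 et.
rewrite (inv1p_taylor d t)// lerD2l /gap.
have D0 : 0 <= D by lra.
have key : eps ^+ 2 / (2 + D) <= (t - d) ^+ 2 / (1 + t).
  rewrite ler_pdivrMr; last lra.
  rewrite mulrAC ler_pdivlMr; last lra.
  have e2 : eps ^+ 2 <= (t - d) ^+ 2.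
    by rewrite -[leRHS]real_normK ?num_real// lerXn2r ?nnegrE ?normr_ge0 ?ltW.
  (* Below [d] the factor [1 + t] is at most [1 + D]. Above [d] it is unbounded and is split as
     [(1 + d) + (t - d)], where [eps ^+ 2 * (t - d) <= (t - d) ^+ 2] absorbs the growing term. *)
  have [td|td] := leP t d.
    by apply: ler_pM; rewrite ?sqr_ge0//; lra.
  rewrite gtr0_norm in et; last lra.
  have e3 : eps ^+ 2 * (t - d) <= (t - d) ^+ 2.
    rewrite [leRHS]expr2 ler_wpM2r//; first lra.
    by apply: le_trans (ltW et); rewrite expr2 ger_pMl ?ltW.
  have e4 : eps ^+ 2 * (1 + d) <= (t - d) ^+ 2 * (1 + d).
    by rewrite ler_wpM2r//; lra.
  have e5 : (t - d) ^+ 2 * (2 + d) <= (t - d) ^+ 2 * (2 + D).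
    by rewrite ler_wpM2l ?sqr_ge0//; lra.
  lra.
have sq : 1 / (1 + D) ^+ 2 <= 1 / (1 + d) ^+ 2.
  rewrite !div1r lef_pV2 ?posrE ?exprn_gt0; try lra.
  by rewrite lerXn2r// ?nnegrE; lra.
have := ler_pM _ _ key sq.
rewrite !mulf_div !mulr1; apply.
  by rewrite divr_ge0 ?sqr_ge0//; lra.
by rewrite divr_ge0// sqr_ge0.
Qed.

(** When [d] is the mean of [b] over [Z], the linear term vanishes and this is Jensen's
    inequality. *)
Lemma sum_inv1p_tangent {R : realType} {I : finType} (b : I -> R) (Z : {set I})
    (d : R) : 0 <= d -> (forall i, 0 <= b i) ->
  #|Z|%:R * inv1p d - (\sum_(i in Z) b i - #|Z|%:R * d) / (1 + d) ^+ 2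
    <= \sum_(i in Z) inv1p (b i).
Proof.
move=> d0 b0.
have -> : #|Z|%:R * inv1p d - (\sum_(i in Z) b i - #|Z|%:R * d) / (1 + d) ^+ 2
    = \sum_(i in Z) (inv1p d - (b i - d) / (1 + d) ^+ 2).
  rewrite sumrB -mulr_suml sumrB !sumr_const.
  by rewrite -[inv1p d *+ _]mulr_natl -[d *+ _]mulr_natl.
by apply: ler_sum => i _; exact: inv1p_tangent.
Qed.

(** Jensen with a gain. On [Z'] the tangent at its own mean [d'] yields [inv1p d'], which beats the
    tangent at [d] by the gap; on the rest the tangent at [d] is used. The linear terms cancel
    because [d] is the mean over all of [Z]. *)
Lemma sum_inv1p_gap {R : realType} {I : finType} (b : I -> R)
    (Z Z' : {set I}) (d d' eps D : R) :
  0 < eps < 1 -> 0 <= d <= D -> 0 <= d' -> eps < `|d' - d| ->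
  (forall i, 0 <= b i) -> Z' \subset Z ->
  \sum_(i in Z) b i = #|Z|%:R * d -> \sum_(i in Z') b i = #|Z'|%:R * d' ->
  #|Z|%:R * inv1p d + #|Z'|%:R * gap eps D <= \sum_(i in Z) inv1p (b i).
Proof.
move=> e01 dD d'0 dd' b0 sZ bZ bZ'.
have d0 : 0 <= d by case/andP: dD.
have cZ : #|Z|%:R = #|Z'|%:R + #|Z :\: Z'|%:R :> R.
  by rewrite -natrD -(cardsID Z' Z) (setIidPr sZ).
have := bZ; rewrite (big_setID Z')/= (setIidPr sZ) bZ' => bD.
rewrite [leRHS](big_setID Z')/= (setIidPr sZ).
have h1 := sum_inv1p_tangent b Z' d' d'0 b0.
rewrite bZ' subrr mul0r subr0 in h1.
have h2 := sum_inv1p_tangent b (Z :\: Z') d d0 b0.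
have h3 := inv1p_gap eps D d d' e01 dD d'0 dd'.
have {h3} := ler_wpM2l (ler0n _ #|Z'|) h3.
have bD' : \sum_(i in Z :\: Z') b i = #|Z|%:R * d - #|Z'|%:R * d' by lra.
move: h2; rewrite bD' cZ; set w := (1 + d) ^+ 2.
rewrite !mulrDr mulrN mulrA; set g := gap eps D.
have -> : (#|Z'|%:R + #|Z :\: Z'|%:R) * d - #|Z'|%:R * d' - #|Z :\: Z'|%:R * d
  = - (#|Z'|%:R * (d' - d)) :> R by ring.
lra.
Qed.

(** * Cells, saturated sets and the energy *)

(* Junk value: the mean over the empty set is [0]. *)
Definition mean {R : realType} {I : finType} (f : I -> R) (Z : {set I}) : R :=
  #|Z|%:R^-1 * \sum_(i in Z) f i.

Lemma mean_ge0 {R : realType} {I : finType} (f : I -> R) (Z : {set I}) :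
  (forall i, 0 <= f i) -> 0 <= mean f Z.
Proof. by move=> f0; rewrite mulr_ge0 ?invr_ge0// sumr_ge0. Qed.

Lemma card_mul_mean {R : realType} {I : finType} (f : I -> R) (Z : {set I}) :
  #|Z|%:R * mean f Z = \sum_(i in Z) f i.
Proof.
have [->|Z0] := eqVneq Z set0; first by rewrite cards0 mul0r big_set0.
by rewrite /mean mulVKf// pnatr_eq0 cards_eq0.
Qed.

(* [C] sends a point to its class for some equivalence relation. *)
Definition cell_map {I : finType} (C : I -> {set I}) : Prop :=
  (forall i, i \in C i) /\ (forall i j, j \in C i -> C j = C i).

Lemma cell_map_sym {I : finType} (C : I -> {set I}) i j :
  cell_map C -> (j \in C i) = (i \in C j).
Proof. by case=> h1 h2; apply/idP/idP => /h2 ->. Qed.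

(** That is, [Z] is a union of cells. *)
Definition saturated {I : finType} (C : I -> {set I}) (Z : {set I}) : Prop :=
  forall i, i \in Z -> C i \subset Z.

(** Double counting: after exchanging the sums, each [f j] is counted by the [#|C j|] points of its
    cell, with weight [#|C j|^-1]. *)
Lemma sum_mean_cell {R : realType} {I : finType} (f : I -> R)
    (C : I -> {set I}) (Z : {set I}) : cell_map C -> saturated C Z ->
  \sum_(i in Z) mean f (C i) = \sum_(i in Z) f i.
Proof.
move=> cC sZ.
under eq_bigr do rewrite /mean mulr_sumr.
rewrite (exchange_big_dep (mem Z))/=; last first.
  by move=> i j iZ; move/subsetP: (sZ i iZ); apply.
apply: eq_bigr => j jZ.
rewrite (eq_bigl (fun i => i \in C j)); last first.
  move=> i; rewrite /= (cell_map_sym _ i j cC) andb_idl//.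
  by apply/subsetP/sZ.
rewrite (eq_bigr (fun=> #|C j|%:R^-1 * f j)); last first.
  by move=> i /= ij; rewrite (cC.2 j i ij).
rewrite sumr_const -[LHS]mulr_natl mulVKf// pnatr_eq0 cards_eq0.
by apply/set0Pn; exists j; exact: cC.1.
Qed.

Lemma sum_mean_cellT {R : realType} {I : finType} (f : I -> R)
    (C : I -> {set I}) : cell_map C -> \sum_i mean f (C i) = \sum_i f i.
Proof.
move=> cC; have := sum_mean_cell f C setT cC (fun _ _ => subsetT _).
by rewrite !(eq_bigl _ _ (fun i => in_setT i)).
Qed.

Lemma sum_cells {R : realType} {I : finType} (C : I -> {set I}) (F : I -> R) :
  cell_map C -> \sum_i F i = \sum_(Z in C @: setT) \sum_(i in Z) F i.
Proof.
move=> cC; rewrite (partition_big C (mem (C @: setT)))/=; last first.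
  by move=> i _; rewrite imset_f.
apply: eq_bigr => _ /imsetP[j _ ->]; apply: eq_bigl => i.
by apply/eqP/idP => [<-|/cC.2//]; exact: cC.1.
Qed.

Definition energy {R : realType} {I : finType} (f : I -> R)
    (C : I -> {set I}) : R := \sum_i inv1p (mean f (C i)).

Lemma energy_ge0 {R : realType} {I : finType} (f : I -> R) C :
  (forall i, 0 <= f i) -> 0 <= energy f C.
Proof. by move=> f0; apply: sumr_ge0 => i _; rewrite inv1p_ge0 ?mean_ge0. Qed.

Lemma energy_le {R : realType} {I : finType} (f : I -> R) C :
  (forall i, 0 <= f i) -> energy f C <= #|I|%:R.
Proof.
move=> f0; rewrite -sum1_card natr_sum.
by apply: ler_sum => i _; rewrite inv1p_le1 ?mean_ge0.
Qed.

(** Within one cell of [C], Jensen with a gain is applied to [i |-> mean f (C' i)]. As [Z'] is a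
    union of cells of [C'], this averaging preserves the mean over [Z'], so the deviation survives.
    Cells missing [G] use plain Jensen; an empty [G] thus gives monotonicity under refinement. *)
Lemma energy_gain {R : realType} {I : finType} (f : I -> R)
    (C C' : I -> {set I}) (G : {set I}) (eps D : R) :
  0 < eps < 1 -> 0 <= D -> (forall i, 0 <= f i) ->
  cell_map C -> cell_map C' -> (forall i, C' i \subset C i) ->
  (forall i, i \in G -> mean f (C i) <= D /\
     exists Z' : {set I}, [/\ Z' \subset C i, saturated C' Z',
       eps ^+ 2 * #|C i|%:R <= #|Z'|%:R & eps < `|mean f Z' - mean f (C i)|]) ->
  energy f C + eps ^+ 2 * gap eps D * #|G|%:R <= energy f C'.
Proof.
move=> e01 D0 f0 cC cC' CC' GP.
have g0 : 0 < gap eps D by apply: gap_gt0 => //; case/andP: e01.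
have -> : #|G|%:R = \sum_i (i \in G)%:R :> R.
  by rewrite -sum1_card natr_sum [LHS]big_mkcond; apply: eq_bigr => i _; case: ifP.
rewrite /energy mulr_sumr -big_split/= (sum_cells C)// [leRHS](sum_cells C)//.
apply: ler_sum => _ /imsetP[i0 _ ->].
set Z := C i0.
have sat : saturated C' Z by move=> i iZ; rewrite /Z -(cC.2 _ _ iZ).
have b0 i : 0 <= mean f (C' i) by exact: mean_ge0.
rewrite big_split/= -mulr_sumr.
rewrite (eq_bigr (fun=> inv1p (mean f Z))) => [|i iZ]; last by rewrite (cC.2 _ _ iZ).
rewrite sumr_const -[_ *+ #|_|]mulr_natl.
have bZ : \sum_(i in Z) mean f (C' i) = #|Z|%:R * mean f Z.
  by rewrite sum_mean_cell// card_mul_mean.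
have [/exists_inP[i iZ iG]|/exists_inPn noG] := boolP [exists i in Z, i \in G].
  have [] := GP i iG; rewrite (cC.2 _ _ iZ) -/Z => mD [Z' [sZ satZ' cZ' dZ']].
  have bZ' : \sum_(i in Z') mean f (C' i) = #|Z'|%:R * mean f Z'.
    by rewrite sum_mean_cell// card_mul_mean.
  apply: le_trans (sum_inv1p_gap _ Z Z' (mean f Z) (mean f Z') eps D
    e01 _ _ dZ' b0 sZ bZ bZ'); last exact: mean_ge0; last first.
    by rewrite mean_ge0.
  rewrite lerD2l mulrAC ler_wpM2r ?(ltW g0)//.
  (* [Z'] has at least [eps ^+ 2 * #|Z|] points, and [#|Z|] bounds the share of [G] in the cell. *)
  apply: le_trans cZ'; rewrite ler_wpM2l ?sqr_ge0//.
  rewrite -natr_sum ler_nat -sum1_card.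
  by apply: leq_sum => j _; case: (_ \in _).
rewrite [X in _ + _ * X]big1 => [|i iZ]; last by rewrite (negbTE (noG i iZ)).
rewrite mulr0 addr0.
have := sum_inv1p_tangent _ Z (mean f Z) (mean_ge0 _ _ f0) b0.
by rewrite bZ subrr mul0r subr0.
Qed.

(** * Balanced partitions separating a family of sets *)

Lemma partition_classes {T : finType} (P : exc_partition T) :
  partition (classes P) (~: exc_class P).
Proof. by case: P. Qed.

Lemma set_of_card {T : finType} (V : {set T}) (s : nat) : (s <= #|V|)%N ->
  exists2 Z : {set T}, Z \subset V & #|Z| = s.
Proof.
case/card_geqP => e [ue se sub]; exists [set x in e].
  by apply/subsetP => x; rewrite inE; exact: sub.
by rewrite cardsE (card_uniqP ue).
Qed.

(* Blocks must lie in a single atom of the algebra generated by [S]; a maximal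
   family leaves fewer than [s] points of [U] uncovered in each of the at most
   [2 ^ #|S|] atoms. *)
Lemma maximal_equal_blocks {T : finType} (U : {set T}) (S : {set {set T}})
    (s : nat) : (0 < s)%N ->
  exists D : {set {set T}}, [/\ trivIset D,
    forall Z, Z \in D -> #|Z| = s /\ Z \subset U,
    forall Z W, Z \in D -> W \in S -> Z \subset W \/ [disjoint Z & W] &
    (#|U :\: cover D| <= 2 ^ #|S| * s)%N].
Proof.
move=> s0.
pose sep (Z : {set T}) := [forall W in S, (Z \subset W) || [disjoint Z & W]].
pose ok D := trivIset D &&
  [forall Z in D, [&& #|Z| == s, Z \subset U & sep Z]].
have ok0 : exists D, ok D.
  exists set0; rewrite /ok /trivIset big_set0 /cover big_set0 cards0 eqxx/=.
  by apply/forall_inP => Z; rewrite inE.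
have [D /maxsetP[/andP[tD /forall_inP okD] maxD]] := ex_maxset ok0.
exists D; split=> //.
- by move=> Z /okD/and3P[/eqP].
- by move=> Z W /okD/and3P[_ _ /forall_inP h] /h/orP.
set V := U :\: cover D.
(* [tau x] names the atom containing [x]; more than [s] uncovered points with the same [tau] would
   yield a further block. *)
pose tau x := [set W in S | x \in W].
rewrite -sum1_card (partition_big tau (mem (powerset S)))/=; last first.
  by move=> x _; rewrite inE; apply/subsetP => W; rewrite inE => /andP[].
rewrite -card_powerset -sum_nat_const leq_sum// => t _.
pose F := [set x in V | tau x == t].
rewrite (eq_bigl (fun x => x \in F)) => [|x]; last by rewrite !inE.
rewrite sum1_card leqNgt; apply/negP => big.
have [Z sZ cZ] := set_of_card F s (ltnW big).
have ZV x : x \in Z -> [/\ x \in U, x \notin cover D & tau x = t].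
  move=> /(subsetP sZ); rewrite !inE => /andP[/andP[-> ->]] /eqP ->.
  by split.
have [z zZ] : exists z, z \in Z by apply/set0Pn; rewrite -card_gt0 cZ.
have ZD A : A \in D -> [disjoint Z & A].
  move=> AD; rewrite disjoint_subset; apply/subsetP => x /ZV[_ xD _].
  by apply: contra xD => xA; apply/bigcupP; exists A.
have okZ : ok (Z |: D).
  apply/andP; split.
    apply/trivIsetP => A B; rewrite !in_setU1.
    move=> /predU1P[->|AD] /predU1P[->|BD]; rewrite ?eqxx// => AB.
    - exact: ZD.
    - by rewrite disjoint_sym; exact: ZD.
    - exact: (trivIsetP tD).
  apply/forall_inP => A; rewrite in_setU1 => /predU1P[->|/okD//].
  rewrite cZ eqxx/=; apply/andP; split.
    by apply/subsetP => x /ZV[].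
  apply/forall_inP => W WS; have [zW|zW] := boolP (z \in W).
    apply/orP; left; apply/subsetP => x xZ.
    have : W \in tau z by rewrite inE WS.
    have [_ _ ->] := ZV z zZ; have [_ _ <-] := ZV x xZ.
    by rewrite inE => /andP[].
  apply/orP; right; rewrite disjoint_subset; apply/subsetP => x xZ.
  rewrite inE; apply: contra zW => xW.
  have : W \in tau x by rewrite inE WS.
  have [_ _ ->] := ZV x xZ; have [_ _ <-] := ZV z zZ.
  by rewrite inE => /andP[].
have /= eD := maxD _ okZ (subsetUr _ _).
have [_ /negP[]] := ZV z zZ; apply/bigcupP; exists Z => //.
by rewrite -eD setU11.
Qed.

(** Blocks of size [s = #|T| %/ K], with [K] independent of [T], leave at most
    [2 ^ w * s <= del * #|T|] points of [U] over. The last hypothesis makes them cover half of [T],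
    so there are at least [L]; since [s] exceeds [#|T| / (2 * K)], there are at most [2 * K]. In a
    refinement [U] is the complement of the old exceptional class. *)
Lemma balanced_separating_partition {R : realType} (w L : nat) (del : R) :
  0 < del ->
  exists N : nat, (0 < N)%N /\ forall (T : finType) (U : {set T})
    (S : {set {set T}}), (N <= #|T|)%N -> (#|S| <= w)%N ->
    #|~: U|%:R + del * #|T|%:R <= 2^-1 * #|T|%:R ->
    exists P : exc_partition T, [/\
      balanced P /\ (L <= nclasses P <= N)%N,
      #|exc_class P|%:R <= #|~: U|%:R + del * #|T|%:R,
      ~: U \subset exc_class P &
      forall X W, X \in classes P -> W \in S -> X \subset W \/ [disjoint X & W]].
Proof.
move=> del0.
pose B := Num.Def.archi_bound (2%:R ^+ w / del).
(* [2 * L] serves the lower bound on the number of classes, [B] the bound on the leftover; the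
   successor keeps [K] positive. *)
pose K := (maxn (2 * L) B).+1.
exists (2 * K)%N; split=> // T U S KT Sw UT.
have BK : 2%:R ^+ w <= del * K%:R :> R.
  rewrite mulrC -ler_pdivrMr//; apply: (@le_trans _ _ B%:R).
    by apply/ltW/archi_boundP; rewrite divr_ge0 ?exprn_ge0 ?ltW.
  by rewrite ler_nat leqW// leq_maxr.
pose s := (#|T| %/ K)%N.
have s0 : (0 < s)%N by rewrite divn_gt0// (leq_trans _ KT)// leq_pmull.
have sK : (s * K <= #|T|)%N := leq_trunc_div _ _.
have Ks : (#|T| < (2 * s) * K)%N.
  have := ltn_ceil #|T| (ltn0Sn _ : 0 < K)%N; move=> /leq_trans; apply; rewrite leq_mul2r.
  by apply/orP; right; rewrite -/s mul2n -addnn -addn1 leq_add2l.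
have [D [tD UD sepD cUD]] := maximal_equal_blocks U S s s0.
have pD : partition D (~: ~: cover D).
  rewrite setCK /partition eqxx tD/=; apply/negP => /UD[]; rewrite cards0 => s00.
  by rewrite -s00 in s0.
have cD : #|cover D| = (#|D| * s)%N.
  rewrite -(eqP tD) -sum_nat_const; apply: eq_bigr => Z /UD[].
  by [].
have exc : #|~: cover D|%:R <= #|~: U|%:R + del * #|T|%:R.
  have : (#|~: cover D| <= #|~: U| + 2 ^ #|S| * s)%N.
    apply: leq_trans (leq_add (leqnn _) cUD).
    apply: leq_trans (leq_card_setU _ _); apply: subset_leq_card.
    by apply/subsetP => x; rewrite !inE; case: (x \in U); rewrite ?orbT ?andbT.
  rewrite -(ler_nat R) natrD => /le_trans; apply; rewrite lerD2l natrM natrX.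
  have h1 : 2%:R ^+ #|S| <= 2%:R ^+ w :> R by rewrite ler_weXn2l// ler1n.
  have h2 : s%:R * K%:R <= #|T|%:R :> R by rewrite -natrM ler_nat.
  have h3 : 2%:R ^+ #|S| * s%:R <= del * K%:R * s%:R.
    by rewrite ler_wpM2r// (le_trans h1).
  apply: le_trans h3 _; rewrite -mulrA ler_wpM2l ?(ltW del0)//.
  by rewrite mulrC.
have cT : #|T|%:R = #|cover D|%:R + #|~: cover D|%:R :> R.
  by rewrite -natrD cardsC.
have half : (#|T| <= 2 * (#|D| * s))%N.
  rewrite -cD -(ler_nat R) natrM.
  lra.
exists (ExcPartition pD); split=> //=; last first.
  by rewrite setCS; apply/bigcupsP => Z /UD[].
split.
  by apply/forall_inP => X /UD[-> _]; apply/forall_inP => Y /UD[-> _].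
rewrite /nclasses /=; apply/andP; split.
  have : (s * (2 * L) <= 2 * (#|D| * s))%N.
    rewrite (leq_trans _ half)// (leq_trans _ sK)// leq_mul2l; apply/orP; right.
    by rewrite leqW// leq_maxl.
  by rewrite mulnCA leq_mul2l/= mulnC leq_pmul2r.
have : (#|D| * s < 2 * K * s)%N.
  by rewrite -cD (leq_ltn_trans (max_card _))// mulnAC.
by rewrite ltn_mul2r => /andP[_ /ltnW].
Qed.

(** * Cells of a partition with an exceptional class *)

Definition cell {T : finType} (P : exc_partition T) (x : T) : {set T} :=
  if x \in exc_class P then [set x] else pblock (classes P) x.

Lemma cell_of_class {T : finType} (P : exc_partition T) (X : {set T}) (x : T) :
  X \in classes P -> x \in X -> cell P x = X.
Proof.
move=> XP xX; have /and3P[/eqP cP tP _] := partition_classes P.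
have : x \in cover (classes P) by apply/bigcupP; exists X.
by rewrite cP inE /cell => /negbTE ->; exact: def_pblock.
Qed.

Lemma cell_in_classes {T : finType} (P : exc_partition T) (x : T) :
  x \notin exc_class P -> cell P x \in classes P.
Proof.
move=> xP; have /and3P[/eqP cP tP _] := partition_classes P.
by rewrite /cell (negbTE xP) pblock_mem// cP inE.
Qed.

Lemma cell_map_cell {T : finType} (P : exc_partition T) : cell_map (cell P).
Proof.
have /and3P[/eqP cP tP _] := partition_classes P.
split=> [x|x y].
  rewrite /cell; case: ifPn => xP; first by rewrite inE.
  by rewrite mem_pblock cP inE.
have [xP|xP] := boolP (x \in exc_class P).
  by rewrite {1}/cell xP inE => /eqP ->.
by move=> yx; rewrite (cell_of_class P _ y (cell_in_classes P x xP)).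
Qed.

Lemma saturated_cell {T : finType} (P : exc_partition T) (Z : {set T}) :
  (forall X, X \in classes P -> X \subset Z \/ [disjoint X & Z]) ->
  saturated (cell P) Z.
Proof.
move=> sep x xZ; have [xP|xP] := boolP (x \in exc_class P).
  by rewrite /cell xP sub1set.
have [//|] := sep _ (cell_in_classes P x xP).
move=> /disjoint_setI0/setP/(_ x); rewrite !inE xZ andbT.
by rewrite (cell_map_cell P).1.
Qed.

(** A point exceptional in [P'] has a singleton cell. Any other point is nonexceptional in [P] as
    well, and its class in [P'] meets its class in [P], hence lies inside it by separation. *)
Lemma cell_subset {T : finType} (P P' : exc_partition T) (x : T) :
  exc_class P \subset exc_class P' ->
  (forall X W, X \in classes P' -> W \in classes P ->
     X \subset W \/ [disjoint X & W]) ->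
  cell P' x \subset cell P x.
Proof.
move=> sE sep; have xx := (cell_map_cell P).1 x.
have [xP'|xP'] := boolP (x \in exc_class P').
  by rewrite {1}/cell xP' sub1set.
have xP : x \notin exc_class P by apply: contra xP'; apply/subsetP.
apply: saturated_cell => // X XP'; apply: sep => //.
exact: cell_in_classes.
Qed.

Definition cell2 {T T' : finType} (P : exc_partition T) (Q : exc_partition T')
  (p : T * T') : {set T * T'} := setX (cell P p.1) (cell Q p.2).

Lemma cell_map_cell2 {T T' : finType} (P : exc_partition T)
  (Q : exc_partition T') : cell_map (cell2 P Q).
Proof.
split=> [p|p q]; first by rewrite inE !(cell_map_cell _).1.
rewrite inE => /andP[q1 q2].
by rewrite /cell2 ((cell_map_cell P).2 _ _ q1) ((cell_map_cell Q).2 _ _ q2).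
Qed.

Lemma card_balanced {T : finType} (P : exc_partition T) (X : {set T}) :
  balanced P -> X \in classes P -> (#|X| * nclasses P = #|~: exc_class P|)%N.
Proof.
move=> /forall_inP bP XP; rewrite (card_partition (partition_classes P)).
rewrite mulnC -sum_nat_const; apply: eq_bigr => Y YP.
by apply/eqP; move: (bP X XP) => /forall_inP; apply.
Qed.

(** All blocks of balanced partitions have the same size, so the share of blocks in [K] equals the
    share of nonexceptional positions they occupy; stated without division. *)
Lemma card_block_points {T T' : finType} (P : exc_partition T)
    (Q : exc_partition T') (K : {set {set T} * {set T'}}) :
  balanced P -> balanced Q -> K \subset setX (classes P) (classes Q) ->
  (#|[set p | (cell P p.1, cell Q p.2) \in K]| * (nclasses P * nclasses Q)
    = #|K| * (#|~: exc_class P| * #|~: exc_class Q|))%N.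
Proof.
move=> bP bQ /subsetP sK.
rewrite -sum1_card.
rewrite (partition_big (fun p => (cell P p.1, cell Q p.2)) (mem K))/=; last first.
  by move=> p; rewrite inE.
rewrite big_distrl/= -[RHS]sum_nat_const; apply: eq_bigr => B BK.
have := sK B BK; rewrite inE => /andP[B1 B2].
rewrite -(card_balanced P _ bP B1) -(card_balanced Q _ bQ B2) mulnACA.
congr (_ * _)%N; rewrite -cardsX -sum1_card; apply: eq_bigl => p.
rewrite !inE; apply/andP/andP => [[_ /eqP <-]|[p1 p2]].
  by rewrite !(cell_map_cell _).1.
rewrite (cell_of_class P _ _ B1 p1) (cell_of_class Q _ _ B2 p2).
by rewrite -surjective_pairing.
Qed.

(** * Matrix entries and witnesses of irregularity *)

Definition entries {R : realType} {m n : nat} (A : 'M[R]_(m, n))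
  (p : 'I_m * 'I_n) : R := A p.1 p.2.

Lemma sum_entries {R : realType} {m n : nat} (A : 'M[R]_(m, n))
    (X : {set 'I_m}) (Y : {set 'I_n}) :
  \sum_(x in X) \sum_(y in Y) A x y = \sum_(p in setX X Y) entries A p.
Proof. by rewrite pair_big; apply: eq_bigl => p; rewrite inE. Qed.

Lemma density_mean {R : realType} {m n : nat} (A : 'M[R]_(m, n))
    (X : {set 'I_m}) (Y : {set 'I_n}) :
  density A X Y = mean (entries A) (setX X Y).
Proof. by rewrite /density /mean cardsX natrM sum_entries. Qed.

Definition is_witness {R : realType} (eps : R) {m n : nat} (A : 'M[R]_(m, n))
    (B Z : {set 'I_m} * {set 'I_n}) : bool :=
  [&& Z.1 \subset B.1, Z.2 \subset B.2, eps * #|B.1|%:R <= #|Z.1|%:R,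
      eps * #|B.2|%:R <= #|Z.2|%:R &
      eps < `|density A Z.1 Z.2 - density A B.1 B.2|].

(** A regular block has no witness and gets the pair of empty sets. *)
Definition witness {R : realType} (eps : R) {m n : nat} (A : 'M[R]_(m, n))
    (B : {set 'I_m} * {set 'I_n}) : {set 'I_m} * {set 'I_n} :=
  odflt (set0, set0) [pick Z | is_witness eps A B Z].

Lemma witnessP {R : realType} (eps : R) {m n : nat} (A : 'M[R]_(m, n)) B :
  ~~ regular_block eps A B.1 B.2 -> is_witness eps A B (witness eps A B).
Proof.
move=> irr; rewrite /witness; case: pickP => //= none.
case/negP: irr; apply/forallP => X; apply/forallP => Y; apply/implyP.
case/and4P => h1 h2 h3 h4; have := none (X, Y).
by rewrite /is_witness /= h1 h2 h3 h4/= ltNge => /negbFE.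
Qed.

(** * Energy increment for irregular partitions *)

(** The factors are the guaranteed share of a block filled by its witness, the gap for densities up
    to [8 / eps], and the guaranteed share of positions in irregular blocks of such density. *)
Definition step_gain {R : realType} (eps : R) : R :=
  eps ^+ 2 * gap eps (8 / eps) * (eps / 8).

Lemma step_gain_gt0 {R : realType} (eps : R) : 0 < eps -> 0 < step_gain eps.
Proof.
move=> e0; have D0 : 0 <= 8 / eps by rewrite divr_ge0 ?(ltW e0).
by apply: mulr_gt0; [rewrite mulr_gt0 ?exprn_gt0 ?gap_gt0|rewrite divr_gt0].
Qed.

(** At least a quarter of all positions are nonexceptional, so the set [J] of positions in irregular
    blocks has share at least [eps / 4]. The set [H] of positions in too dense cells has share at
    most [eps / 8]. On [J :\: H] the witnesses, saturated for the finer cells, supply the deviations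
    that [energy_gain] asks for. *)
Lemma irregular_energy_gain {R : realType} (eps : R) {m n : nat}
    (A : 'M[R]_(m, n)) (P P' : exc_partition 'I_m) (Q Q' : exc_partition 'I_n) :
  0 < eps < 1 -> (forall x y, 0 <= A x y) ->
  \sum_p entries A p <= m%:R * n%:R ->
  balanced P -> balanced Q ->
  #|exc_class P|%:R <= 2^-1 * m%:R :> R ->
  #|exc_class Q|%:R <= 2^-1 * n%:R :> R ->
  (forall x, cell P' x \subset cell P x) ->
  (forall y, cell Q' y \subset cell Q y) ->
  (forall B, B \in irregular_blocks eps A P Q ->
     saturated (cell P') (witness eps A B).1 /\
     saturated (cell Q') (witness eps A B).2) ->
  eps * (nclasses P)%:R * (nclasses Q)%:R < #|irregular_blocks eps A P Q|%:R ->
  energy (entries A) (cell2 P Q) + step_gain eps * (m%:R * n%:R)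
    <= energy (entries A) (cell2 P' Q').
Proof.
move=> e01 A0 Amn bP bQ eP eQ rP rQ sat irr.
have e0 : 0 < eps by case/andP: e01.
have D0 : 0 <= 8 / eps by rewrite divr_ge0 ?ltW.
have f0 p : 0 <= entries A p by exact: A0.
set Irr := irregular_blocks eps A P Q in sat irr.
have sIrr : Irr \subset setX (classes P) (classes Q).
  by apply/subsetP => B; rewrite inE => /andP[].
pose J := [set p | (cell P p.1, cell Q p.2) \in Irr].
pose H := [set p | 8 / eps < mean (entries A) (cell2 P Q p)].
(* Markov: the cell means have the same sum as the entries, at most [m * n]. *)
have cH : #|H|%:R <= eps / 8 * (m%:R * n%:R).
  have : 8 / eps * #|H|%:R <= m%:R * n%:R.
    apply: le_trans Amn.
    rewrite -(sum_mean_cellT _ _ (cell_map_cell2 P Q)).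
    rewrite mulr_natr -sumr_const.
    rewrite [leRHS](bigID (mem H))/= -[leLHS]addr0 lerD//; last first.
      by apply: sumr_ge0 => p _; exact: mean_ge0.
    by apply: ler_sum => p; rewrite inE => /ltW.
  move=> h; have := ler_wpM2l (_ : 0 <= eps / 8) h.
  have e1 : eps / 8 * (8 / eps) = 1 by field; rewrite gt_eqF.
  rewrite [eps / 8 * (8 / eps * _)]mulrA e1 mul1r.
  by apply; rewrite divr_ge0 ?ltW.
have cJ : eps / 4 * (m%:R * n%:R) <= #|J|%:R.
  have := card_block_points P Q Irr bP bQ sIrr; rewrite -/J => /(congr1 (fun i => i%:R : R)).
  rewrite !natrM => eJ.
  have cP : 2^-1 * m%:R <= #|~: exc_class P|%:R :> R.
    have : #|exc_class P|%:R + #|~: exc_class P|%:R = m%:R :> R.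
      by rewrite -natrD cardsC card_ord.
    lra.
  have cQ : 2^-1 * n%:R <= #|~: exc_class Q|%:R :> R.
    have : #|exc_class Q|%:R + #|~: exc_class Q|%:R = n%:R :> R.
      by rewrite -natrD cardsC card_ord.
    lra.
  have cPQ : 4^-1 * (m%:R * n%:R) <= #|~: exc_class P|%:R * #|~: exc_class Q|%:R :> R.
    have -> : 4^-1 * (m%:R * n%:R) = 2^-1 * m%:R * (2^-1 * n%:R) :> R by field.
    by apply: ler_pM cP cQ; rewrite mulr_ge0 ?invr_ge0.
  (* The strict inequality [irr] forces an irregular block, hence a class on each side. *)
  have pq0 : 0 < (nclasses P)%:R * (nclasses Q)%:R :> R.
    have [B BI] : exists B, B \in Irr.
      apply/set0Pn; apply: contraTneq irr => ->; rewrite cards0 -leNgt.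
      by rewrite !mulr_ge0 ?ler0n ?(ltW e0).
    have := subsetP sIrr B BI; rewrite inE => /andP[B1 B2].
    rewrite mulr_gt0// ltr0n /nclasses card_gt0; apply/set0Pn.
      by exists B.1.
    by exists B.2.
  rewrite -(ler_pM2r pq0) eJ.
  apply: le_trans (ler_pM _ _ (ltW irr) cPQ); last 2 first.
  - by rewrite !mulr_ge0 ?ler0n ?(ltW e0).
  - by rewrite !mulr_ge0 ?invr_ge0 ?ler0n.
  by rewrite le_eqVlt; apply/orP; left; apply/eqP; ring.
have cG : eps / 8 * (m%:R * n%:R) <= #|J :\: H|%:R.
  have : (#|J| <= #|H| + #|J :\: H|)%N.
    by rewrite -(cardsID H J) leq_add2r subset_leq_card// subsetIr.
  rewrite -(ler_nat R) natrD; lra.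
apply: le_trans (energy_gain (entries A) (cell2 P Q) (cell2 P' Q') (J :\: H) eps
  (8 / eps) e01 D0 f0 (cell_map_cell2 _ _) (cell_map_cell2 _ _) _ _).
- rewrite lerD2l /step_gain -[leLHS]mulrA ler_wpM2l//.
  by rewrite mulr_ge0 ?sqr_ge0// ltW// gap_gt0.
- by move=> p; rewrite setXS.
move=> p; rewrite in_setD [p \in H]inE [p \in J]inE -leNgt => /andP[pH BI].
split=> //.
set B := (cell P p.1, cell Q p.2) in BI *.
have [sat1 sat2] := sat B BI.
have /and5P[w1 w2 w3 w4 w5] : is_witness eps A B (witness eps A B).
  by apply: witnessP; move: BI; rewrite inE => /andP[].
(* The lower bounds on the two sides multiply; this is the source of [eps ^+ 2]. *)
exists (setX (witness eps A B).1 (witness eps A B).2); split.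
- by rewrite setXS.
- move=> q; rewrite inE => /andP[q1 q2].
  by apply: setXS; [exact: sat1|exact: sat2].
- by rewrite !cardsX !natrM expr2 mulrACA ler_pM ?mulr_ge0 ?ler0n ?(ltW e0).
- by move: w5; rewrite !density_mean.
Qed.

(** [P'] and [Q'] separate the old classes, so that cells are refined, and the witnesses of all
    blocks for all [k] matrices, so that these become unions of cells. One matrix gains and the
    other energies do not drop. *)
Lemma energy_increment {R : realType} (eps del : R) (L k N : nat) :
  0 < eps < 1 -> 0 < del ->
  exists N' : nat, (0 < N')%N /\
    forall m n : nat, (N' <= m)%N -> (N' <= n)%N ->
    forall (A : 'I_k -> 'M[R]_(m, n))
      (P : exc_partition 'I_m) (Q : exc_partition 'I_n),
      (forall i x y, 0 <= A i x y) ->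
      (forall i, \sum_p entries (A i) p <= m%:R * n%:R) ->
      balanced P -> balanced Q -> (nclasses P <= N)%N -> (nclasses Q <= N)%N ->
      #|exc_class P|%:R + del * m%:R <= 2^-1 * m%:R ->
      #|exc_class Q|%:R + del * n%:R <= 2^-1 * n%:R ->
      (exists i, eps * (nclasses P)%:R * (nclasses Q)%:R
                   < #|irregular_blocks eps (A i) P Q|%:R) ->
      exists (P' : exc_partition 'I_m) (Q' : exc_partition 'I_n), [/\
        balanced P' /\ balanced Q',
        (L <= nclasses P' <= N')%N /\ (L <= nclasses Q' <= N')%N,
        #|exc_class P'|%:R <= #|exc_class P|%:R + del * m%:R,
        #|exc_class Q'|%:R <= #|exc_class Q|%:R + del * n%:R &
        \sum_i energy (entries (A i)) (cell2 P Q)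
            + step_gain eps * (m%:R * n%:R)
          <= \sum_i energy (entries (A i)) (cell2 P' Q')].
Proof.
move=> e01 del0; have e0 : 0 < eps by case/andP: e01.
(* At most [N] old classes, and one side of a witness for each of [k] matrices and at most [N * N]
   blocks. *)
have [N' [N'0 sepN']] := balanced_separating_partition (N + k * (N * N)) L del del0.
exists N'; split=> // m n mN nN A P Q A0 Amn bP bQ PN QN eP eQ [i0 irr].
pose W p := witness eps (A p.1) p.2.
pose K := setX [set: 'I_k] (setX (classes P) (classes Q)).
have cK : (#|K| <= k * (N * N))%N.
  by rewrite !cardsX cardsT card_ord leq_mul2l leq_mul ?orbT.
have [|||P' [[bP' nP'] eP' uP' sP']] :=
  sepN' 'I_m (~: exc_class P) (classes P :|: [set (W p).1 | p in K]).
- by rewrite card_ord.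
- rewrite (leq_trans (leq_card_setU _ _))// leq_add//.
  exact: leq_trans (leq_imset_card _ _) cK.
- by rewrite setCK card_ord.
have [|||Q' [[bQ' nQ'] eQ' uQ' sQ']] :=
  sepN' 'I_n (~: exc_class Q) (classes Q :|: [set (W p).2 | p in K]).
- by rewrite card_ord.
- rewrite (leq_trans (leq_card_setU _ _))// leq_add//.
  exact: leq_trans (leq_imset_card _ _) cK.
- by rewrite setCK card_ord.
rewrite setCK card_ord in eP' uP'; rewrite setCK card_ord in eQ' uQ'.
exists P', Q'; split=> //.
have rP x : cell P' x \subset cell P x.
  by apply: cell_subset => // X Z XP' ZP; apply: sP' => //; rewrite inE ZP.
have rQ y : cell Q' y \subset cell Q y.
  by apply: cell_subset => // X Z XQ' ZQ; apply: sQ' => //; rewrite inE ZQ.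
have mono i : energy (entries (A i)) (cell2 P Q)
    <= energy (entries (A i)) (cell2 P' Q').
  (* With an empty [G] the gain vanishes and [D] may be [0]. *)
  have := energy_gain (entries (A i)) (cell2 P Q) (cell2 P' Q') set0 eps 0 e01
    (lexx _) (fun p => A0 i p.1 p.2) (cell_map_cell2 _ _) (cell_map_cell2 _ _).
  rewrite cards0 mulr0 addr0; apply=> [p|p]; first by rewrite setXS.
  by rewrite inE.
rewrite (bigD1 i0)//= [leRHS](bigD1 i0)//= addrAC.
apply: lerD; last by apply: ler_sum.
have m0 : 0 <= del * m%:R by rewrite mulr_ge0 ?(ltW del0).
have n0 : 0 <= del * n%:R by rewrite mulr_ge0 ?(ltW del0).
apply: irregular_energy_gain => //; [lra|lra|].
move=> B; rewrite inE => /andP[BPQ _].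
have BK : (i0, B) \in K by rewrite in_setX inE.
split; apply: saturated_cell => X XP.
  by apply: sP' => //; rewrite inE (imset_f (fun p => (W p).1) BK) orbT.
by apply: sQ' => //; rewrite inE (imset_f (fun p => (W p).2) BK) orbT.
Qed.

(** * Iteration until all matrices are regular *)

(** [t] is the number of refinements still allowed, under two budgets: the exceptional classes can
    grow [t] times and stay within share [eps / 2], and [t] gains would push the total energy above
    its maximum [k * (m * n)]. Quantifying [N] after [t] lets the induction hypothesis be used at
    the larger bound [N']. *)
Lemma regular_partition_of_energy {R : realType} (eps del : R) (L k t : nat) :
  0 < eps < 1 -> 0 < del -> forall N : nat,
  exists M : nat, (0 < M)%N /\
    forall m n : nat, (M <= m)%N -> (M <= n)%N ->
    forall (A : 'I_k -> 'M[R]_(m, n))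
      (P : exc_partition 'I_m) (Q : exc_partition 'I_n),
      (forall i x y, 0 <= A i x y) ->
      (forall i, \sum_p entries (A i) p <= m%:R * n%:R) ->
      balanced P -> balanced Q ->
      (L <= nclasses P <= N)%N -> (L <= nclasses Q <= N)%N ->
      #|exc_class P|%:R + t%:R * (del * m%:R) <= eps / 2 * m%:R ->
      #|exc_class Q|%:R + t%:R * (del * n%:R) <= eps / 2 * n%:R ->
      k%:R * (m%:R * n%:R) < \sum_i energy (entries (A i)) (cell2 P Q)
        + t%:R * (step_gain eps * (m%:R * n%:R)) ->
      exists (P' : exc_partition 'I_m) (Q' : exc_partition 'I_n), [/\
        (L <= nclasses P' <= M)%N, (L <= nclasses Q' <= M)%N &
        forall i, regular_partition eps (A i) P' Q'].
Proof.
move=> e01 del0; have /andP[e0 e1] := e01.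
elim: t => [|t IH] N.
  (* With no refinement left the energy hypothesis is contradictory, so any positive bound will
     do. *)
  exists 1%N; split=> // m n _ _ A P Q A0 Amn _ _ _ _ _ _.
  rewrite mul0r addr0 ltNge => /negP[].
  have -> : k%:R * (m%:R * n%:R) = \sum_(i < k) m%:R * n%:R :> R.
    by rewrite sumr_const card_ord -[RHS]mulr_natl.
  apply: ler_sum => i _; apply: le_trans (energy_le _ _ _) _.
    by move=> p; exact: A0.
  by rewrite card_prod !card_ord natrM.
have [N' [N'0 incr]] := energy_increment eps del L k N e01 del0.
have [M [M0 IHM]] := IH N'.
(* [N] serves when the given partitions are already regular, [N'] makes the sides large enough to
   refine once, and [M] comes from the remaining steps. *)
exists (maxn N (maxn N' M)); split; first by rewrite !leq_max M0 !orbT.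
move=> m n; rewrite !geq_max => /and3P[mN mN' mM] /and3P[nN nN' nM].
move=> A P Q A0 Amn bP bQ /andP[LP PN] /andP[LQ QN] eP eQ En.
have m0 : 0 < m%:R :> R by rewrite ltr0n (leq_trans M0).
have n0 : 0 < n%:R :> R by rewrite ltr0n (leq_trans M0).
have dm0 : 0 < del * m%:R by rewrite mulr_gt0.
have dn0 : 0 < del * n%:R by rewrite mulr_gt0.
have tm0 : 0 <= t%:R * (del * m%:R) by rewrite mulr_ge0 // ltW.
have tn0 : 0 <= t%:R * (del * n%:R) by rewrite mulr_ge0 // ltW.
rewrite -natr1 mulrDl mul1r in eP; rewrite -natr1 mulrDl mul1r in eQ.
rewrite -natr1 mulrDl mul1r in En.
have em : eps * m%:R < m%:R by rewrite gtr_pMl.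
have en : eps * n%:R < n%:R by rewrite gtr_pMl.
have em0 : 0 < eps * m%:R by rewrite mulr_gt0.
have en0 : 0 < eps * n%:R by rewrite mulr_gt0.
have [/forallP reg|/forallPn[i]] := boolP [forall i,
    #|irregular_blocks eps (A i) P Q|%:R
      <= eps * (nclasses P)%:R * (nclasses Q)%:R].
  exists P, Q; split=> [||i].
  - by rewrite LP leq_max PN.
  - by rewrite LQ leq_max QN.
  by split=> //; lra.
rewrite -ltNge => irr.
have [||P' [Q' [[bP' bQ'] [nP' nQ'] eP' eQ' En']]] :=
  incr m n mN' nN' A P Q A0 Amn bP bQ PN QN _ _ (ex_intro _ i irr); [lra|lra|].
have [|||P2 [Q2 [/andP[LP2 P2M] /andP[LQ2 Q2M] reg]]] :=
  IHM m n mM nM A P' Q' A0 Amn bP' bQ' nP' nQ'; [lra|lra|lra|].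
exists P2, Q2; split=> //.
  by rewrite LP2 !leq_max P2M !orbT.
by rewrite LQ2 !leq_max Q2M !orbT.
Qed.

(** * Normalization and conclusion *)

Lemma normalize_mx_ge0 {R : realType} {m n : nat} (A : 'M[R]_(m, n)) :
  (forall x y, 0 <= A x y) -> forall x y, 0 <= normalize_mx A x y.
Proof.
move=> A0 x y; rewrite mxE mulr_ge0// divr_ge0 ?mulr_ge0//.
by apply: sumr_ge0 => ? _; apply: sumr_ge0.
Qed.

(** Equality holds when [entry_norm A] is nonzero; otherwise the left side is [0] by the convention
    on division. *)
Lemma sum_entries_normalize {R : realType} {m n : nat} (A : 'M[R]_(m, n)) :
  (forall x y, 0 <= A x y) ->
  \sum_p entries (normalize_mx A) p <= m%:R * n%:R.
Proof.
move=> A0.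
have -> : \sum_p entries (normalize_mx A) p
    = m%:R * n%:R / entry_norm A * entry_norm A.
  have {2}-> : entry_norm A = \sum_p entries A p.
    rewrite /entry_norm pair_big; apply: eq_bigr => p _.
    by rewrite ger0_norm.
  by rewrite mulr_sumr; apply: eq_bigr => p _; rewrite /entries mxE.
have [->|s0] := eqVneq (entry_norm A) 0; first by rewrite mulr0 mulr_ge0.
by rewrite divfK.
Qed.

Theorem theorem10 (R : realType) (eps : R) (L k : nat) :
  0 < eps < 1 -> (0 < L)%N -> (0 < k)%N ->
  exists M : nat, (0 < M)%N /\
    forall m n : nat, (M <= m)%N -> (M <= n)%N ->
    forall A : 'I_k -> 'M[R]_(m, n),
      (forall i x y, 0 <= A i x y) ->
      exists (P : exc_partition 'I_m) (Q : exc_partition 'I_n),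
        [/\ (L <= nclasses P <= M)%N,
            (L <= nclasses Q <= M)%N &
            forall i, normalized_regular_partition eps (A i) P Q].
Proof.
move=> e01 _ _; have /andP[e0 e1] := e01.
pose g := step_gain eps; have g0 : 0 < g by exact: step_gain_gt0.
(* The total energy lies between [0] and [k * (m * n)], and [t] gains of [g * (m * n)] exceed this
   range. *)
pose t := Num.Def.archi_bound (k%:R / g).
have kt : k%:R < t%:R * g.
  by rewrite -ltr_pdivrMr//; apply: archi_boundP; rewrite divr_ge0 ?(ltW g0).
(* [eps / 2] is shared among the initial partition and [t] refinements, hence [t.+1] portions. *)
pose del : R := eps / 2 / t.+1%:R.
have del0 : 0 < del by rewrite !divr_gt0.
have delt : del + t%:R * del = eps / 2.
  rewrite -[X in X + _]mul1r -mulrDl addrC natr1 /del mulrC divfK//.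
  by rewrite pnatr_eq0.
(* Nothing has to be separated at the start, so the family is empty and [w] is [0]. *)
have [N [N0 init]] := balanced_separating_partition 0 L del del0.
have [M [M0 main]] := regular_partition_of_energy eps del L k t e01 del0 N.
exists (maxn N M); split; first by rewrite leq_max N0.
move=> m n; rewrite !geq_max => /andP[mN mM] /andP[nN nM] A A0.
have m0 : 0 < m%:R :> R by rewrite ltr0n (leq_trans M0).
have n0 : 0 < n%:R :> R by rewrite ltr0n (leq_trans M0).
have tdel : 0 <= t%:R * del by rewrite mulr_ge0 // ltW.
have dl : del <= 2^-1 by lra.
have start (d : nat) : (N <= d)%N -> exists P : exc_partition 'I_d, [/\ balanced P,
    (L <= nclasses P <= N)%N &
    #|exc_class P|%:R + t%:R * (del * d%:R) <= eps / 2 * d%:R].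
  move=> dN; have [|||P [[bP nP] eP _ _]] := init 'I_d setT set0.
  - by rewrite card_ord.
  - by rewrite cards0.
  - by rewrite setCT cards0 add0r card_ord ler_wpM2r.
  exists P; split=> //.
  rewrite setCT cards0 add0r card_ord in eP.
  by rewrite -delt mulrDl -mulrA lerD2r.
have [P [bP nP eP]] := start m mN; have [Q [bQ nQ eQ]] := start n nN.
have B0 i := normalize_mx_ge0 (A i) (A0 i).
have [||P' [Q' [/andP[LP' PM'] /andP[LQ' QM'] reg]]] := main m n mM nM
  (fun i => normalize_mx (A i)) P Q B0 _ bP bQ nP nQ eP eQ.
- by move=> i; exact: sum_entries_normalize.
- apply: (@lt_le_trans _ _ (t%:R * g * (m%:R * n%:R))).
    by rewrite ltr_pM2r// mulr_gt0.
  rewrite -mulrA lerDr; apply: sumr_ge0 => i _; apply: energy_ge0 => p.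
  exact: B0.
exists P', Q'; split=> //.
  by rewrite LP' leq_max PM' orbT.
by rewrite LQ' leq_max QM' orbT.
Qed.
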